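(* Let $X$ be a complex infinite-dimensional Banach space with an unconditional basis $(e_n)_{n\ge0}$. Then a typical $T\in(\mathcal{P}_1(X),\mathrm{SOT})$ has no non-trivial closed invariant ideals. If moreover $X^*$ is separable, then a typical $T\in(\mathcal{P}_1(X),\mathrm{SOT}^* )$ has no non-trivial closed invariant ideals.
   Context: Let $X$ be a complex Banach space with basis $(e_n)_{n\ge0}$ and biorthogonal functionals $(e_n^* )_{n\ge0}$. A vector $x$ is positive ($x\ge0$) if $\langle e_n^*,x\rangle\ge 0$ for all $n$; $x\le y$ means $y-x\ge0$. A bounded operator $T$ on $X$ is positive if $Tx\ge0$ for every $x\ge0$. $\mathcal{P}_1(X)$ is the set of bounded positive operators on $X$ with $\|T\|\le1$. For $x=\sum_n x_ne_n\in X$, $|x|=\sum_n|x_n|e_n$. A closed ideal of $X$ is a closed vector subspace $V$ such that for all $x,y\in X$, $|x|\le|y|$ and $y\in V$ imply $x\in V$; it is non-trivial if $V\ne\{0\}$ and $V\ne X$, and invariant for $T$ if $T(V)\subseteq V$. $\mathrm{SOT}$: $T_i\to T$ iff $\|T_ix-Tx\|\to0$ for every $x\in X$. $\mathrm{SOT}^*$: $T_i\to T$ iff $\|T_ix-Tx\|\to0$ for every $x\in X$ and $\|T_i^*x^*-T^*x^*\|\to0$ for every $x^*\in X^*$. For a topology $\tau$ making $\mathcal{P}_1(X)$ a Baire space, ''a typical $T\in(\mathcal{P}_1(X),\tau)$ has property (P)'' means that the set of $T\in\mathcal{P}_1(X)$ with (P) is comeager, i.e. contains a dense $G_\delta$ subset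 of $(\mathcal{P}_1(X),\tau)$. *)

(* Defs.v *)
From HB Require Import structures.
From mathcomp Require Import all_boot all_order all_algebra.
From mathcomp Require Import complex.
From mathcomp Require Import all_classical all_reals all_analysis.
From mathcomp Require Import borel_hierarchy.

Set Implicit Arguments.
Unset Strict Implicit.
Unset Printing Implicit Defensive.
Import Order.TTheory GRing.Theory Num.Theory numFieldNormedType.Exports.
Local Open Scope classical_set_scope.
Local Open Scope complex_scope.
Local Open Scope ring_scope.

Lemma normcRe (R : realType) (z : R[i]) : `|z| = (complex.Re `|z|)%:C.
Proof. by rewrite RRe_real// normr_real. Qed.

Section BoundedOperators.
Context {R : realType} {X Y : normedModType R[i]}.

Definition is_bounded_op : {pred X -> Y} :=
  fun f => `[< linear f /\ continuous f >].

Lemma is_bounded_op_submod_closed : submod_closed is_bounded_op.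
Proof.
split=> [|a f g].
  apply/asboolP; split; first by move=> a u v /=; rewrite scaler0 addr0.
  by move=> x; exact: cvg_cst.
move=> /asboolP[lf cf] /asboolP[lg cg]; apply/asboolP; split.
  move=> b u v; rewrite !fctE lf lg.
  rewrite !scalerDr !scalerA [a * b]mulrC -!addrA; congr (_ + _).
  by rewrite addrCA.
move=> x; apply: cvgD; last exact: cg.
by apply: cvgZr; exact: cf.
Qed.

HB.instance Definition _ :=
  GRing.isSubmodClosed.Build R[i] (X -> Y) is_bounded_op
    is_bounded_op_submod_closed.

Record bounded_op := BoundedOp {
  bounded_op_fun :> X -> Y;
  bounded_op_funP : bounded_op_fun \in is_bounded_op }.

HB.instance Definition _ := [isSub for bounded_op_fun].
HB.instance Definition _ := [Choice of bounded_op by <:].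
HB.instance Definition _ := [SubChoice_isSubLmodule of bounded_op by <:].

Lemma bounded_op_linear (f : bounded_op) : linear f.
Proof. by have /asboolP[] := bounded_op_funP f. Qed.

Lemma bounded_op_continuous (f : bounded_op) : continuous f.
Proof. by have /asboolP[] := bounded_op_funP f. Qed.

HB.instance Definition _ (f : bounded_op) :=
  GRing.isLinear.Build R[i] X Y *:%R f (bounded_op_linear f).

(* Norms of an R[i]-normed module are R[i]-valued (and real), so the supremum
   is taken over real parts. *)
Definition opnorm (f : bounded_op) : R :=
  sup [set complex.Re `|f x| | x in [set x : X | `|x| <= 1]].

Lemma normRe (V : normedModType R[i]) (v : V) : `|v| = (complex.Re `|v|)%:C.
Proof. by rewrite RRe_real// normr_real. Qed.

Lemma opnorm_has_sup (f : bounded_op) :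
  has_sup [set complex.Re `|f x| | x in [set x : X | `|x| <= 1]].
Proof.
split; first by exists (complex.Re `|f 0|), 0 => //=; rewrite normr0.
have /linear_boundedP/pinfty_ex_gt0[M M0 fM] :
    bounded_near f (nbhs (0 : X)).
  exact/linear_bounded_continuous/bounded_op_continuous.
exists (complex.Re M) => _ [x /= x1 <-].
have : `|f x| <= M.
  by rewrite (le_trans (fM x))// -[leRHS]mulr1 ler_wpM2l// ltW.
by rewrite lecE => /andP[].
Qed.

Lemma le_opnorm (f : bounded_op) (x : X) : `|f x| <= (opnorm f)%:C * `|x|.
Proof.
have [->|x0] := eqVneq x 0; first by rewrite linear0 !normr0 mulr0.
rewrite -ler_pdivrMr ?normr_gt0//.
have -> : `|f x| / `|x| = `|f (`|x|^-1 *: x)|.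
  by rewrite linearZ normrZ normfV normr_id mulrC.
rewrite normRe lecR; apply: ub_le_sup; first exact: (opnorm_has_sup f).2.
by exists (`|x|^-1 *: x) => //=; rewrite normfZV.
Qed.

Lemma opnorm_le (f : bounded_op) (M : R) :
  (forall x : X, `|x| <= 1 -> `|f x| <= M%:C) -> opnorm f <= M.
Proof.
move=> fM; apply: ge_sup; first exact: (opnorm_has_sup f).1.
by move=> _ [x /= x1 <-]; rewrite -lecR -normRe; exact: fM.
Qed.

Lemma opnorm_ge0 (f : bounded_op) : 0 <= opnorm f.
Proof.
apply: ub_le_sup; first exact: (opnorm_has_sup f).2.
by exists 0 => /=; rewrite ?linear0 normr0.
Qed.

Lemma le_opnorm1 (f : bounded_op) (x : X) :
  `|x| <= 1 -> `|f x| <= (opnorm f)%:C.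
Proof.
move=> x1; rewrite (le_trans (le_opnorm f x))// -[leRHS]mulr1.
by rewrite ler_wpM2l// ler0c opnorm_ge0.
Qed.

Lemma opnormD (f g : bounded_op) :
  (opnorm (f + g))%:C <= (opnorm f)%:C + (opnorm g)%:C.
Proof.
rewrite -rmorphD lecR; apply: opnorm_le => x x1.
by rewrite (le_trans (ler_normD _ _))// rmorphD lerD// le_opnorm1.
Qed.

Lemma opnormZ_le (l : R[i]) (f : bounded_op) :
  (opnorm (l *: f))%:C <= `|l| * (opnorm f)%:C.
Proof.
rewrite [in leRHS](normcRe l) -rmorphM lecR; apply: opnorm_le => x x1.
rewrite rmorphM/= -normcRe.
have -> : `|(l *: f : bounded_op) x| = `|l| * `|f x| by rewrite -normrZ.
by rewrite ler_wpM2l// le_opnorm1.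
Qed.

Lemma opnormZ (l : R[i]) (f : bounded_op) :
  (opnorm (l *: f))%:C = `|l| * (opnorm f)%:C.
Proof.
apply/eqP; rewrite eq_le opnormZ_le/=.
have [->|l0] := eqVneq l 0; first by rewrite normr0 mul0r ler0c opnorm_ge0.
rewrite -ler_pdivlMl ?normr_gt0// -normfV.
by rewrite (le_trans _ (opnormZ_le _ _))// scalerA mulVf// scale1r.
Qed.

Lemma opnorm_eq0 (f : bounded_op) : (opnorm f)%:C = 0 -> f = 0.
Proof.
move=> f0; apply/val_inj/funext => x /=; apply/eqP.
by rewrite -normr_le0 (le_trans (le_opnorm f x))// f0 mul0r.
Qed.

HB.instance Definition _ := Lmodule_isNormed.Build R[i] bounded_op
  opnormD opnormZ opnorm_eq0.

End BoundedOperators.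
Arguments bounded_op {R} X Y.

Section Dual.
Context {R : realType}.

Definition dual (X : normedModType R[i]) : normedModType R[i] :=
  bounded_op X R[i]^o.

Lemma adjoint_subproof (X Y : normedModType R[i]) (T : bounded_op X Y)
  (f : dual Y) : (f : bounded_op Y R[i]^o) \o T \in is_bounded_op.
Proof.
apply/asboolP; split; first by move=> a u v /=; rewrite !linearP.
by move=> x; apply: continuous_comp; exact: bounded_op_continuous.
Qed.

Definition adjoint (X Y : normedModType R[i]) (T : bounded_op X Y)
  (f : dual Y) : dual X := BoundedOp (adjoint_subproof T f).

End Dual.

Section Bases.
Context {R : realType} {X : normedModType R[i]}.
Implicit Types (e : nat -> X) (x y : X) (T : bounded_op X X) (V : set X).

Definition infinite_dimensional : Prop :=
  forall s : seq X, exists x, forall a : nat -> R[i],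
    x <> \sum_(k < size s) a k *: s`_k.

Definition expands e x (a : nat -> R[i]) : Prop :=
  series (fun n => a n *: e n) @ \oo --> x.

Definition schauder_basis e : Prop := forall x, exists! a, expands e x a.

(* [coef e x n] is <e_n^*, x>, where (e_n^* ) are the biorthogonal functionals
   of the basis e; junk unless e is a basis. *)
Definition coef e x : nat -> R[i] := xget (fun=> 0) [set a | expands e x a].

Definition unconditionally_convergent (u : nat -> X) : Prop :=
  forall s : nat -> nat, bijective s -> cvgn (series (u \o s)).

Definition unconditional_basis e : Prop :=
  schauder_basis e /\
  forall x, unconditionally_convergent (fun n => coef e x n *: e n).

(* In the order of R[i], 0 <= z means that z is real and nonnegative. *)
Definition is_positive e x : Prop := forall n, 0 <= coef e x n.

Definition vle e x y : Prop := is_positive e (y - x).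

(* The limit exists for every x when e is an unconditional basis; otherwise it
   may be junk. *)
Definition vabs e x : X := limn (series (fun n => `|coef e x n| *: e n)).

Definition positive_op e T : Prop :=
  forall x, is_positive e x -> is_positive e (T x).

Definition P1 e : set (bounded_op X X) :=
  [set T | positive_op e T /\ `|T| <= 1].

Definition closed_ideal e V : Prop :=
  [/\ closed V,
      V 0 /\ (forall (a : R[i]) x y, V x -> V y -> V (a *: x + y)) &
      forall x y, vle e (vabs e x) (vabs e y) -> V y -> V x].

Definition nontrivial V : Prop := V <> [set 0] /\ V <> setT.

Definition invariant T V : Prop := T @` V `<=` V.

Definition no_nontrivial_closed_invariant_ideal e T : Prop :=
  ~ exists V, [/\ closed_ideal e V, nontrivial V & invariant T V].

Definition P1_SOT e : topologicalType :=
  initial_topology (fun T : P1 e => (val T : X -> X) : {ptws X -> X}).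

(* The norm on [dual X] is the operator norm, so this is the coarsest topology
   making T |-> T x and T |-> T^* f norm-continuous for all x and f. *)
Definition P1_SOTstar e : topologicalType :=
  initial_topology (fun T : P1 e =>
    ((val T : X -> X) : {ptws X -> X},
     adjoint (val T) : {ptws dual X -> dual X})).

End Bases.
Arguments infinite_dimensional {R} X.

Definition separable_space (T : topologicalType) : Prop :=
  exists2 D : set T, countable D & dense D.

Definition typical (T : topologicalType) (P : set T) : Prop :=
  exists G : set T, [/\ Gdelta G, dense G & G `<=` P].

(* Main.v *)
Require Import Defs.
From HB Require Import structures.
From mathcomp Require Import all_boot all_order all_algebra.
From mathcomp Require Import complex.
From mathcomp Require Import all_classical all_reals all_analysis.
From mathcomp Require Import zify lra.

(** An operator T whose matrix entries <e_m^*, T e_n> are all nonzero has no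
    non-trivial closed invariant ideal.  Indeed a nonzero closed ideal V
    contains a vector y with some coordinate y_n nonzero, and y_n e_n is
    dominated by |y|, so e_n lies in V [closed_ideal_basis].  By invariance
    T e_n lies in V; all its coordinates are nonzero, so for the same reason
    every e_m lies in V, and V is the whole space [closed_ideal_full].

    It remains to see that the positive contractions with nonvanishing entries
    form a dense G_delta set [typical_nonzero_entries].  They form the
    intersection of the countably many sets where one given entry is nonzero,
    and these are open: T |-> T e_n is continuous for both topologies, and
    coordinate functionals are continuous.  For density, take a rank-one
    positive contraction S all of whose entries are positive
    [positive_entries_ex].  A positive contraction T is the limit of the
    positive contractions (1 - t) T + t S as t > 0 tends to 0, and no entry of
    these can vanish, since the entries of T are nonnegative.

    Two theorems on bases support this.  The coordinate functionals of a
    Schauder basis are continuous [coef_continuous]; this comes from a closed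
    graph theorem for the whole sequence of partial sum projections
    [closed_pointwise_bounded_family], proved with Baire's theorem.  And |y| is
    an honest vector, with coordinates |y_n| [coef_vabs], because a series that
    converges under all rearrangements still converges after multiplication of
    its terms by bounded scalars [unconditional_multiplier]. *)

Set Implicit Arguments.
Unset Strict Implicit.
Unset Printing Implicit Defensive.
Import Order.TTheory GRing.Theory Num.Theory numFieldNormedType.Exports.
Local Open Scope classical_set_scope.
Local Open Scope complex_scope.
Local Open Scope ring_scope.

(** * Restriction of scalars to the reals *)

(** Baire's theorem and the comparison of series with real series are theorems
    about spaces with real scalars and a real-valued norm.  [realified X] is
    the same additive group with this structure; the topology is the same
    [nbhs_realified], so convergence statements transfer both ways. *)
Definition realified (R : realType) (X : normedModType R[i]) : Type := X.

Section Realified.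
Context {R : realType} (X : normedModType R[i]).
Local Notation rX := (realified X).

HB.instance Definition _ := GRing.Zmodule.copy rX X.

Let scale (a : R) (x : rX) : rX := a%:C *: (x : X).

Let scaleA a b v : scale a (scale b v) = scale (a * b) v.
Proof. by rewrite /scale scalerA rmorphM. Qed.

Let scale1 : left_id 1 scale.
Proof. by move=> x; rewrite /scale scale1r. Qed.

Let scaleDr : right_distributive scale +%R.
Proof. by move=> a x y; rewrite /scale scalerDr. Qed.

Let scaleDl v : {morph scale^~ v : a b / a + b}.
Proof. by move=> a b; rewrite /scale rmorphD scalerDl. Qed.

HB.instance Definition _ :=
  GRing.Zmodule_isLmodule.Build R rX scaleA scale1 scaleDr scaleDl.

Let norm (x : rX) : R := complex.Re `|x : X|.

Let normC (x : rX) : (norm x)%:C = `|x : X|.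
Proof. by rewrite /norm -normRe. Qed.

Let norm_triangle (x y : rX) : norm (x + y) <= norm x + norm y.
Proof. by rewrite -lecR rmorphD/= !normC ler_normD. Qed.

Let norm_scale (a : R) (x : rX) : norm (a *: x) = `|a| * norm x.
Proof.
apply: complexI; rewrite rmorphM/= !normC.
rewrite /GRing.scale/= /scale normrZ; congr (_ * _).
by rewrite normc_def/= expr0n addr0 sqrtr_sqr.
Qed.

Let norm0_eq0 (x : rX) : norm x = 0 -> x = 0.
Proof. by move=> x0; apply/(@normr0_eq0 _ X); rewrite -normC x0. Qed.

HB.instance Definition _ :=
  Lmodule_isNormed.Build R rX norm_triangle norm_scale norm0_eq0.

Lemma normr_realified (x : X) : `|x| = `|x : rX|%:C.
Proof. by rewrite -normC. Qed.

Lemma scale_realified (a : R) (x : rX) : a *: x = a%:C *: (x : X).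
Proof. by []. Qed.

Lemma nbhs_realified (x : X) : nbhs x = nbhs (x : rX).
Proof.
apply/seteqP; split=> A /nbhs_ballP[e/= e0 xA]; apply/nbhs_ballP.
  have er : e = (complex.Re e)%:C by rewrite RRe_real ?gtr0_real.
  rewrite er ltcR in e0.
  exists (complex.Re e) => //= y; rewrite -ball_normE/= => xy; apply: xA.
  by rewrite -ball_normE/= er normr_realified ltcR.
exists e%:C; first by rewrite /= ltcR.
move=> y; rewrite -ball_normE/= normr_realified ltcR => xy; apply: xA.
by rewrite -ball_normE.
Qed.

Lemma cvg_realified (T : Type) (F : set_system T) (f : T -> X) (x : X) :
  (f @ F --> x) = ((f : T -> rX) @ F --> (x : rX)).
Proof. by rewrite /cvg_to nbhs_realified. Qed.

End Realified.

Section RealifiedComplete.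
Context {R : realType} (X : completeNormedModType R[i]).
Local Notation rX := (realified X).

Let complete (F : set_system rX) : ProperFilter F -> cauchy F -> cvg F.
Proof.
move=> FF /cauchy_ballP cF; have : cauchy (F : set_system X).
  apply/cauchy_ballP => e e0.
  have er : e = (complex.Re e)%:C by rewrite RRe_real ?gtr0_real.
  rewrite er ltcR in e0; have := cF _ e0; apply: filterS => -[x y].
  by rewrite -!ball_normE/= er normr_realified ltcR.
move=> /cauchy_cvgP/cvg_ex[l Fl]; apply/cvg_ex; exists l.
by move=> A; rewrite -nbhs_realified; exact: Fl.
Qed.

HB.instance Definition _ := Uniform_isComplete.Build rX complete.

End RealifiedComplete.

(** * A closed graph theorem for sequences of linear maps *)

Section DominatedSeries.
Context {R : realType} (W : completeNormedModType R).

Lemma geometric_dominated_series (w : nat -> W) (c : R) :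
  (forall k, `|w k| <= c * 2^-1 ^+ k) ->
  exists2 l, series w @ \oo --> l &
    forall k, `|l - series w k| <= c * 2 * 2^-1 ^+ k.
Proof.
move=> wc.
have cw : cvgn (series w).
  apply: normed_cvg; apply: series_le_cvg; last first.
  - by apply: (@is_cvg_geometric_series _ c 2^-1); rewrite ger0_norm; lra.
  - exact: wc.
  - by move=> n; rewrite /= (le_trans _ (wc n)).
  - by move=> n; rewrite /= normr_ge0.
exists (limn (series w)) => // k.
(* The bound telescopes: 2 (2^-k - 2^-n) is the sum of 2^-j for k <= j < n. *)
have tail n : (k <= n)%N ->
    `|series w n - series w k| <= c * 2 * 2^-1 ^+ k - c * 2 * 2^-1 ^+ n.
  elim: n => [|n IH]; first by rewrite leqn0 => /eqP ->; rewrite !subrr normr0.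
  rewrite leq_eqVlt => /predU1P[->|]; first by rewrite !subrr normr0.
  rewrite ltnS => /IH {}IH; rewrite seriesSr addrAC.
  have := ler_normD (series w n - series w k) (w n).
  by have := wc n; rewrite exprS; lra.
have c0 : 0 <= c.
  by have := le_trans (normr_ge0 _) (wc 0%N); rewrite expr0 mulr1.
have cv : `|series w n - series w k| @[n --> \oo] -->
    `|limn (series w) - series w k|.
  by apply: cvg_norm; apply: cvgB => //; exact: cvg_cst.
rewrite -(cvg_lim _ cv)//; apply: limr_le.
  by apply/cvg_ex; eexists; exact: cv.
exists k => // n /= /tail /le_trans; apply.
by rewrite gerBl// mulr_ge0 ?mulr_ge0 ?exprn_ge0.
Qed.

End DominatedSeries.

Section ClosedGraph.
Context {R : realType} (Z W : completeNormedModType R).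
Variable P : nat -> {linear Z -> W}.
Hypothesis P_bounded : forall x, exists M, forall N, `|P N x| <= M.
(* Closedness of the graph of x |-> (P N x)_N, for uniform convergence in N. *)
Hypothesis P_closed : forall (s : nat -> Z) (x : Z) (b : nat -> W),
  s @ \oo --> x ->
  (forall eps, 0 < eps -> exists k0, forall k N, (k0 <= k)%N ->
    `|b N - P N (s k)| <= eps) ->
  forall N, P N x = b N.

(** The sets A M where all |P N x| are at most M cover Z, so by Baire's theorem
    one of them is dense in some ball around a point x0.  Differences of
    elements of A M then approximate every vector of the ball of the same radius
    around 0, and a homothety gives all sizes t. *)
Lemma almost_open : exists2 K : R, 0 <= K &
  forall (y : Z) (t : R), `|y| < t ->
    exists a, (forall N, `|P N a| <= K * t) /\ `|y - a| < t / 2.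
Proof.
pose A (M : nat) := [set x | forall N, `|P N x| <= M%:R].
have [M /denseNE[U [[x0 [Ux0 oU]] UA]]] : exists M, ~ dense (~` closure (A M)).
  apply/existsNP => dA.
  have /(_ setT) : dense (\bigcap_M ~` closure (A M)).
    apply: Baire => M; split; last exact: dA.
    by apply: closed_openC; exact: closed_closure.
  case; [by exists 0|exact: openT|move=> x [_ xA]].
  have [B xB] := P_bounded x.
  apply: (xA (Num.truncn B).+1) => //; apply: subset_closure => N /=.
  by rewrite (le_trans (xB N))// ltW// truncnS_gt.
have /nbhs_ballP[r /= r0 xr] : nbhs x0 U by exact: open_nbhs_nbhs.
have clA x : ball x0 r x -> forall d, 0 < d -> exists2 a, A M a & `|x - a| < d.
  move=> /xr Ux d d0.
  have : closure (A M) x.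
    apply: contrapT => nx.
    by have : (U `&` ~` closure (A M)) x by []; rewrite UA.
  move=> /(_ (ball x d) (nbhsx_ballx _ _ d0))[a [Aa xa]]; exists a => //.
  by move: xa; rewrite -ball_normE.
exists (M%:R * 2 / r); first by rewrite !mulr_ge0// invr_ge0 ltW.
move=> y t yt; have t0 : 0 < t by exact: le_lt_trans yt.
have s0 : 0 < t / r by rewrite divr_gt0.
have r4 : 0 < r / 4 by rewrite divr_gt0.
have [z -> zr] : exists2 z, y = (t / r) *: z & `|z| < r.
  exists ((t / r)^-1 *: y); first by rewrite scalerA divff ?scale1r ?gt_eqF.
  rewrite normrZ gtr0_norm ?invr_gt0// invf_div -mulrA gtr_pMr//.
  by rewrite mulrC ltr_pdivrMr// mul1r.
have [a0 Aa0 xa0] := clA x0 (ballxx _ r0) _ r4.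
have [|a1 Aa1 xa1] := clA (x0 + z) _ _ r4.
  by rewrite -ball_normE/= opprD addrA subrr sub0r normrN.
exists ((t / r) *: (a1 - a0)); split.
  move=> N; rewrite linearZ normrZ linearB (gtr0_norm s0).
  have -> : M%:R * 2 / r * t = t / r * (M%:R + M%:R) by lra.
  rewrite ler_pM2l// (le_trans (ler_normB _ _))// lerD//; first exact: Aa1.
  exact: Aa0.
have -> : (t / r) *: z - (t / r) *: (a1 - a0) =
    (t / r) *: ((x0 + z - a1) - (x0 - a0)).
  rewrite -scalerBr; congr (_ *: _).
  by rewrite -[x0 + z - a1]addrA [x0 + (z - a1)]addrC addrKA opprK opprB
    addrA addrAC.
rewrite normrZ gtr0_norm//.
have -> : t / 2 = t / r * (r / 2) by rewrite mulrA divfK// gt_eqF.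
rewrite ltr_pM2l// (le_lt_trans (ler_normB _ _))//.
by move: xa0 xa1; lra.
Qed.

(** As in the proof of the open mapping theorem, [almost_open] is applied to
    the successive remainders, which writes x as a series of vectors a_k with
    |P N a_k| at most K t / 2^k for every N.  The series of the P N a_k converge
    uniformly in N, and closedness identifies their sums with P N x. *)
Theorem closed_pointwise_bounded_family :
  exists C : R, forall N x, `|P N x| <= C * `|x|.
Proof.
have [K K0 PK] := almost_open.
have /choice[g gP] (yt : Z * R) : exists a, `|yt.1| < yt.2 ->
    (forall N, `|P N a| <= K * yt.2) /\ `|yt.1 - a| < yt.2 / 2.
  have [/PK[a aP]|n] := pselect (`|yt.1| < yt.2); first by exists a.
  by exists 0 => /n.
(* y k is the remainder after k steps and a k the k-th term. *)
have bound x t : `|x| < t -> forall N, `|P N x| <= K * t * 2.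
  move=> xt N.
  pose fix y k := if k is j.+1 then y j - g (y j, t * 2^-1 ^+ j) else x.
  pose a k := g (y k, t * 2^-1 ^+ k).
  have yP k : `|y k| < t * 2^-1 ^+ k.
    elim: k => [|k IH]; first by rewrite expr0 mulr1.
    by have [_] := gP (_, _) IH; rewrite /= exprSr mulrA.
  have aP k M : `|P M (a k)| <= K * t * 2^-1 ^+ k.
    by have [+ _] := gP (_, _) (yP k) => /(_ M); rewrite /= mulrA.
  have Sy k : series a k = x - y k.
    elim: k => [|k IH]; first by rewrite /series/= big_geq// subrr.
    by rewrite seriesSr IH/= opprB addrA addrAC.
  have yto0 : `|y k| @[k --> \oo] --> 0.
    apply: (@squeeze_cvgr _ _ _ _ (cst 0) (geometric t 2^-1)).
    - by near=> k; rewrite normr_ge0 /= ltW.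
    - exact: cvg_cst.
    - by apply: cvg_geometric; rewrite ger0_norm; lra.
  have Sx : series a @ \oo --> x.
    rewrite (_ : series a = fun k => x - y k); last exact/funext.
    rewrite -[X in _ --> X]subr0; apply: cvgB; first exact: cvg_cst.
    exact/norm_cvg0P.
  have /choice[b bP] M : exists l, forall k,
      `|l - P M (series a k)| <= K * t * 2 * 2^-1 ^+ k.
    have [l _ lP] := geometric_dominated_series (fun k => aP k M).
    by exists l => k; rewrite /series linear_sum; exact: lP.
  have -> : P N x = b N.
    apply: (P_closed Sx) => eps eps0.
    have : geometric (K * t * 2) 2^-1 @ \oo --> (0 : R).
      by apply: cvg_geometric; rewrite ger0_norm; lra.
    move=> /cvgr0_norm_le/(_ _ eps0)[k0 _ k0P]; exists k0 => k M kk.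
    by rewrite (le_trans (bP M k))// (le_trans _ (k0P k kk))// ler_norm.
  have := bP N 0%N; rewrite /series/= big_geq// linear0 subr0.
  by rewrite expr0 mulr1.
(* K * t * 2 with t := 2 |x|, which is larger than |x| unless x = 0. *)
exists (K * 4) => N x; have [->|x0] := eqVneq x 0.
  by rewrite linear0 !normr0 mulr0.
have nx0 : 0 < `|x| by rewrite normr_gt0.
have /bound/(_ N) : `|x| < 2 * `|x| by lra.
by lra.
Unshelve. all: by end_near. Qed.

End ClosedGraph.

(** * Continuity of the coordinate functionals of a Schauder basis *)

Section ComplexLines.
Context {R : realType}.

Lemma normc_i : `|'i%C : R[i]| = 1.
Proof. by rewrite normc_def/= expr0n expr1n add0r sqrtr1. Qed.

Lemma cvg_complex (b : nat -> R[i]) (r s : R) :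
  (fun k => complex.Re (b k)) @ \oo --> r ->
  (fun k => complex.Im (b k)) @ \oo --> s ->
  (b : nat -> R[i]^o) @ \oo --> (r +i* s : R[i]^o).
Proof.
move=> br bs; apply/cvgrPdist_lt => eps eps0.
have er : eps = (complex.Re eps)%:C by rewrite RRe_real ?gtr0_real.
rewrite er ltcR in eps0 *; have e2 : 0 < complex.Re eps / 2 by rewrite divr_gt0.
move/cvgrPdist_lt: br => /(_ _ e2); move/cvgrPdist_lt: bs => /(_ _ e2).
apply: filterS2 => k sk rk.
have -> : (r +i* s) - b k =
    (r - complex.Re (b k))%:C + 'i%C * (s - complex.Im (b k))%:C.
    by rewrite [LHS]complexE !raddfB.
rewrite (le_lt_trans (ler_normD _ _))// normrM normc_i mul1r !normc_def/=.
by rewrite !expr0n !addr0 !sqrtr_sqr -rmorphD ltcR; move: sk rk; lra.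
Qed.

(** When v is nonzero, the real and imaginary parts of the scalars form Cauchy
    sequences. *)
Lemma cvg_scale_line (X : normedModType R[i]) (v z : X) (b : nat -> R[i]) :
  (fun k => b k *: v) @ \oo --> z -> exists c, z = c *: v.
Proof.
have [->|v0] := eqVneq v 0.
  move=> bz; exists 0; rewrite scaler0; apply/esym/(cvg_unique _ _ bz) => //=.
  under eq_fun do rewrite scaler0.
  exact: cvg_cst.
move=> bz; have nv : 0 < `|v| by rewrite normr_gt0.
have cauchy_part (p : R[i] -> R) : (forall x y, p (x - y) = p x - p y) ->
    (forall x, `|p x|%:C <= `|x|) -> cvgn (p \o b).
  move=> pB px; apply/cauchy_cvgP/cauchyP => eps eps0.
  have d0 : 0 < (eps / 2)%:C * `|v| by rewrite mulr_gt0// ltcR divr_gt0.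
  move/cvgrPdist_lt: bz => /(_ _ d0)[N _ bz]; exists (p (b N)), N => // k /= Nk.
  rewrite -ball_normE/= -pB -ltcR (le_lt_trans (px _))//.
  rewrite -(ltr_pM2r nv) -normrZ scalerBl.
  have -> : b N *: v - b k *: v = (z - b k *: v) - (z - b N *: v).
    by rewrite opprB [RHS]addrC addrA subrK.
  rewrite (le_lt_trans (ler_normB _ _))// [eps]splitr rmorphD/= mulrDl.
  by rewrite ltrD// bz//=.
have /cvg_ex[r br] : cvgn (@complex.Re R \o b).
  by apply: cauchy_part => [x y|x]; [rewrite raddfB|exact: normc_ge_Re].
have /cvg_ex[s bs] : cvgn (@complex.Im R \o b).
  apply: cauchy_part => [x y|x]; [by rewrite raddfB|].
  by have := normc_ge_Re (x * 'i%C); rewrite normrM normc_i mulr1 ReiNIm normrN.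
exists (r +i* s); apply: (cvg_unique _ bz) => //=.
by apply: cvgZr_tmp; exact: cvg_complex.
Qed.

End ComplexLines.

Lemma series_linear (R : realType) (X : normedModType R[i]) (v : nat -> X)
    (c : R[i]) (a b : nat -> R[i]) N :
  series (fun n => (c * a n + b n) *: v n) N =
  c *: series (fun n => a n *: v n) N + series (fun n => b n *: v n) N.
Proof.
rewrite /series/= scaler_sumr -big_split.
by apply: eq_bigr => i _; rewrite scalerDl scalerA.
Qed.

Section SchauderBasis.
Context {R : realType} {X : completeNormedModType R[i]} {e : nat -> X}.
Hypothesis Be : schauder_basis e.

Lemma expands_coef x : expands e x (coef e x).
Proof. by have [a [xa _]] := Be x; apply: xgetPex; exists a. Qed.

Lemma expandsP x a : expands e x a -> coef e x = a.
Proof.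
by move=> xa; have [b [_ b_uniq]] := Be x;
  rewrite -(b_uniq _ xa) -(b_uniq _ (@expands_coef x)).
Qed.

Lemma coef_linear (c : R[i]) x y :
  coef e (c *: x + y) = (fun n => c * coef e x n + coef e y n).
Proof.
apply: expandsP; rewrite /expands.
have -> : series (fun n => (c * coef e x n + coef e y n) *: e n) =
    (fun N => c *: series (fun n => coef e x n *: e n) N +
              series (fun n => coef e y n *: e n) N).
  exact/funext/series_linear.
by apply: cvgD; [apply: cvgZl_tmp|]; exact: expands_coef.
Qed.

Lemma coefZ (c : R[i]) x n : coef e (c *: x) n = c * coef e x n.
Proof.
have e0 : coef e 0 = fun=> 0.
  apply/funext => m; have := congr1 (@^~ m) (coef_linear (-1) 0 0).
  by rewrite scaler0 addr0 mulN1r addNr.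
by have := coef_linear c x 0; rewrite addr0 => ->; rewrite e0 addr0.
Qed.

Lemma coefB x y n : coef e (x - y) n = coef e x n - coef e y n.
Proof.
by rewrite addrC -scaleN1r coef_linear mulN1r addrC.
Qed.

Lemma coef_basis m n : coef e (e m) n = (m == n)%:R.
Proof.
suff -> : coef e (e m) = fun n => (m == n)%:R by [].
apply: expandsP; rewrite /expands; apply: cvg_near_cst.
exists m.+1 => // N /= mN.
rewrite /series/= (bigD1_seq m) ?iota_uniq ?mem_index_iota//= eqxx scale1r.
by rewrite big1 ?addr0// => i /negPf im; rewrite eq_sym im scale0r.
Qed.

Lemma basis_neq0 n : e n != 0.
Proof.
apply/eqP => en0; have := coef_basis n n.
rewrite en0 -(scale0r (e n)) coefZ mul0r eqxx => /eqP.
by rewrite eq_sym oner_eq0.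
Qed.

Definition psum N (x : realified X) : realified X :=
  series (fun n => coef e x n *: e n) N.

Let psum0 x : psum 0 x = 0.
Proof. by rewrite /psum /series/= big_geq. Qed.

Let psumB N (x : X) : psum N.+1 x - psum N x = coef e x N *: e N.
Proof. by rewrite /psum seriesSr addrC addKr. Qed.

Let psum_linear N : linear (psum N).
Proof.
by move=> a x y; rewrite /psum scale_realified coef_linear series_linear.
Qed.

HB.instance Definition _ N :=
  GRing.isLinear.Build R (realified X) (realified X) *:%R (psum N)
    (psum_linear N).

Let cvg_psum (x : realified X) : psum ^~ x @ \oo --> x.
Proof. by rewrite -cvg_realified; exact: expands_coef. Qed.

(** The partial sum projections are pointwise bounded, and their graph is
    closed: if s_k tends to x and psum N (s_k) to b_N uniformly in N, then each
    b_(N+1) - b_N is a multiple c_N e_N, and b_N tends to x by uniformity, so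
    that (c_n) are the coordinates of x.  Hence the projections are uniformly
    bounded, and so are the differences of consecutive ones. *)
Lemma coef_bounded n :
  exists2 K : R, 0 < K & forall x, `|coef e x n| <= K%:C * `|x|.
Proof.
have [C PC] : exists C : R, forall N (x : realified X), `|psum N x| <= C * `|x|.
  apply: (closed_pointwise_bounded_family (P := psum)).
    move=> x; have /cvg_seq_bounded : cvgn (psum ^~ x).
      by apply/cvg_ex; exists x.
    by move=> /pinfty_ex_gt0[M _ xM]; exists M => N; exact: xM.
  move=> s x b sx unif.
  have Psb N : psum N (s k) @[k --> \oo] --> b N.
    apply/cvgrPdist_le => eps /unif[k0 k0P]; exists k0 => // k kk; exact: k0P.
  have b0 : b 0%N = 0.
    have : psum 0%N (s k) @[k --> \oo] --> (0 : realified X).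
      by apply: cvg_near_cst; apply: nearW => k; rewrite psum0.
    exact: (cvg_unique _ (Psb 0%N)).
  have /choice[c bc] m : exists c : R[i], (b m.+1 - b m : X) = c *: e m.
    apply: (cvg_scale_line (b := fun k => coef e (s k) m)).
    rewrite cvg_realified; under eq_fun do rewrite -psumB.
    exact: cvgB.
  have bE N : b N = series (fun n => c n *: e n) N.
    elim: N => [|N IH]; first by rewrite /series/= big_geq.
    by rewrite seriesSr -bc -IH addrC subrK.
  suff bx : b @ \oo --> x.
    have /expandsP xc : expands e x c.
      by rewrite /expands cvg_realified -(_ : b = series _)//; exact/funext.
    by move=> N; rewrite bE -xc.
  apply/cvgrPdist_le => eps eps0.
  have e3 : 0 < eps / 3 by rewrite divr_gt0.
  have [k0 k0P] := unif _ e3.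
  move/cvgrPdist_le : sx => /(_ _ e3)[k1 _ k1P].
  pose k := maxn k0 k1.
  have /cvgrPdist_le/(_ _ e3) := @cvg_psum (s k); apply: filterS => N skN.
  have bk := k0P k N (leq_maxl _ _); have xk := k1P k (leq_maxr _ _).
  have -> : x - b N = (x - s k) + (s k - psum N (s k)) - (b N - psum N (s k)).
    by rewrite addrA subrK opprB addrA subrK.
  have := ler_normB ((x - s k) + (s k - psum N (s k))) (b N - psum N (s k)).
  have := ler_normD (x - s k) (s k - psum N (s k)).
  by move: bk xk skN; rewrite /=; lra.
pose r := `|e n : realified X|.
have r0 : 0 < r by rewrite -ltcR -normr_realified normr_gt0 basis_neq0.
exists ((`|C| + `|C| + 1) / r) => [|x].
  by rewrite divr_gt0// ltr_wpDl ?addr_ge0.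
have rC : 0 < r%:C by rewrite ltcR.
rewrite -(ler_pM2r rC) -normr_realified -normrZ.
rewrite -psumB !normr_realified -!rmorphM/= lecR mulrAC divfK ?gt_eqF//.
have := PC n.+1 x; have := PC n x.
have := ler_normB (psum n.+1 x) (psum n x).
have := ler_norm C; have := normr_ge0 (x : realified X).
move=> x0 CC; have : C * `|x : realified X| <= `|C| * `|x : realified X|.
  by rewrite ler_wpM2r.
by lra.
Qed.

Lemma coef_continuous n : continuous (fun x => coef e x n : R[i]^o).
Proof.
have [K K0 KP] := coef_bounded n.
move=> x; apply/cvgrPdist_lt => eps eps0.
have KC : 0 < K%:C by rewrite ltcR.
have d0 : 0 < eps / K%:C by rewrite divr_gt0.
near=> y; rewrite -coefB (le_lt_trans (KP _))// mulrC -ltr_pdivlMr//.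
Unshelve. all: by end_near.
Qed.

End SchauderBasis.

(** * Unconditional convergence and bounded multipliers *)

Section BlockRearrangement.
Variables (b : nat -> nat) (L : nat -> seq nat).
Hypotheses (b0 : b 0 = 0%N) (b_lt : forall j, (b j < b j.+1)%N).
Hypothesis L_perm : forall j, perm_eq (L j) (index_iota (b j) (b j.+1)).

(** Permuting each of the consecutive intervals [b j, b (j+1)[ in the order
    prescribed by L j gives a permutation of nat. *)
Lemma block_rearrangement : exists2 s : nat -> nat,
  bijective s & forall j, map s (index_iota (b j) (b j.+1)) = L j.
Proof.
have /choice[blk blkP] k : exists j, (b j <= k < b j.+1)%N.
  elim: k => [|k [j /andP[jk kj]]].
    by exists 0%N; have := b_lt 0; rewrite b0.
  have [kj1|kj1] := ltnP k.+1 (b j.+1); first by exists j; rewrite kj1 leqW.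
  by exists j.+1; rewrite kj1 (leq_ltn_trans kj).
have blk_uniq k j : (b j <= k < b j.+1)%N -> blk k = j.
  have b_mono : {homo b : i j / (i <= j)%N} 
    by apply: homo_leq => // [? ? ?|?]; [exact: leq_trans|exact: ltnW].
  move=> /andP[jk kj]; have /andP[bk kb] := blkP k.
  by case: (ltngtP (blk k) j) => // /b_mono; lia.
have size_L j : size (L j) = (b j.+1 - b j)%N.
  by rewrite (perm_size (L_perm j)) size_iota.
have uniq_L j : uniq (L j) by rewrite (perm_uniq (L_perm j)) iota_uniq.
have mem_L j k : (k \in L j) = (b j <= k < b j.+1)%N.
  by rewrite (perm_mem (L_perm j)) mem_index_iota.
pose s k := nth 0%N (L (blk k)) (k - b (blk k)).
have s_in k : s k \in L (blk k).
  by apply: mem_nth; rewrite size_L; have := blkP k; lia.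
exists s; last first.
  move=> j; apply: (@eq_from_nth _ 0%N).
    by rewrite size_map size_iota size_L.
  move=> i; rewrite size_map size_iota => ij.
  rewrite (nth_map 0%N) ?size_iota// nth_iota// /s (blk_uniq _ j) ?addKn//; lia.
exists (fun m => b (blk m) + index m (L (blk m)))%N => k.
  have -> : blk (s k) = blk k by apply: blk_uniq; rewrite -mem_L.
  rewrite index_uniq ?size_L//; have := blkP k; lia.
have kL : k \in L (blk k) by rewrite mem_L.
have blkE : blk (b (blk k) + index k (L (blk k)))%N = blk k.
  by apply: blk_uniq; have := kL; rewrite -index_mem size_L; lia.
by rewrite /s blkE addKn nth_index.
Qed.

End BlockRearrangement.

Section Unconditional.
Context {R : realType} {X : completeNormedModType R[i]}.
Implicit Types (u : nat -> X) (s : seq nat).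

(** Otherwise there are finite sets s_j, beyond any index, over which the sum of
    u exceeds eps.  A permutation that lists each s_j without interruption, at
    the beginning of a block, gives a series that is not Cauchy. *)
Lemma unconditional_cauchy u (eps : R[i]) :
  unconditionally_convergent u -> 0 < eps ->
  exists N, forall n s, subseq s (index_iota N n) ->
    `|\sum_(k <- s) u k| <= eps.
Proof.
move=> cu eps0; apply: contrapT => /forallNP nN.
have /choice[F FP] N : exists ns : nat * seq nat,
    subseq ns.2 (index_iota N ns.1) /\ eps < `|\sum_(k <- ns.2) u k|.
  have /existsNP[n /existsNP[s /not_implyP[sN /negP us]]] := nN N.
  exists (n, s); split=> //.
  by rewrite real_ltNge// ?normr_real// gtr0_real.
pose fix b j := if j is i.+1 then (F (b i)).1 else 0%N.
pose s j := (F (b j)).2.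
have sP j : subseq (s j) (index_iota (b j) (b j.+1)) by have [] := FP (b j).
have us j : eps < `|\sum_(k <- s j) u k| by have [] := FP (b j).
have b_lt j : (b j < b j.+1)%N.
  rewrite ltnNge; apply/negP => bj; have := sP j; have := us j.
  rewrite /index_iota (eqP bj) subseq0 => + /eqP sj.
  by rewrite sj big_nil normr0 => /(lt_trans eps0); rewrite ltxx.
pose L j := s j ++ [seq k <- index_iota (b j) (b j.+1) | k \notin s j].
have L_perm j : perm_eq (L j) (index_iota (b j) (b j.+1)).
  have /subseq_uniqP -/(_ (iota_uniq _ _)) sE := sP j.
  by rewrite /L {1}sE perm_filterC.
have [r rbij rL] := block_rearrangement (erefl : b 0%N = 0%N) b_lt L_perm.
have /cauchy_cvgP/cauchy_seriesP/(_ _ eps0) := cu r rbij.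
move=> [[A B] [/= [N1 _ AN] [N2 _ BN]] AB].
have b_ge j : (j <= b j)%N by elim: j => // j /leq_ltn_trans; apply.
pose j := maxn N1 N2; have := us j.
have := AB (b j, b j + size (s j))%N; rewrite /= => /(_ _)/wrap[].
  split; [apply: AN|apply: BN] => /=.
    exact: leq_trans (leq_maxl _ _) (b_ge j).
  by rewrite (leq_trans (leq_maxr N1 N2))// (leq_trans (b_ge j))// leq_addr.
have -> : \sum_(b j <= k < b j + size (s j)) (u \o r) k = \sum_(k <- s j) u k.
  have sjE : s j = map r (index_iota (b j) (b j + size (s j))).
    have := congr1 (take (size (s j))) (rL j).
    rewrite [in X in _ = X]/L take_size_cat// -map_take take_iota => {1}<-.
    have := size_subseq (sP j); rewrite size_iota => /minn_idPl ->.
    by rewrite /index_iota addKn.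
  by rewrite [in RHS]sjE big_map.
by move=> /lt_trans /[apply]; rewrite ltxx.
Qed.

(** The norm is convex in each t k, so it is largest when all t k are 0 or 1,
    that is for the sum over a subset of s. *)
Lemma norm_sum_convex_le u (t : nat -> R[i]) s (a : X) (eps : R[i]) :
  (forall k, 0 <= t k <= 1) ->
  (forall s', subseq s' s -> `|a + \sum_(k <- s') u k| <= eps) ->
  `|a + \sum_(k <- s) t k *: u k| <= eps.
Proof.
move=> t01; elim: s a => [|k s IH] a aeps.
  by have := aeps [::] isT; rewrite !big_nil.
have /andP[t0 t1] := t01 k.
rewrite big_cons addrA; apply: IH => s' ss'.
have -> : a + t k *: u k + \sum_(k <- s') u k =
    (1 - t k) *: (a + \sum_(k <- s') u k) +
    t k *: (a + \sum_(k <- k :: s') u k).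
  rewrite big_cons [u k + _]addrC !addrA [a + _ + u k]addrC.
  rewrite [t k *: (u k + _)]scalerDr addrCA -scalerDl subrK scale1r.
  by rewrite addrAC [in RHS]addrC.
have t1' : 0 <= 1 - t k by rewrite subr_ge0.
have -> : eps = (1 - t k) * eps + t k * eps by rewrite -mulrDl subrK mul1r.
rewrite (le_trans (ler_normD _ _))// !normrZ !ger0_norm// lerD//.
  by rewrite ler_wpM2l// aeps// (subseq_trans ss')// subseq_cons.
by rewrite ler_wpM2l// aeps//= eqxx.
Qed.

(** The factor 4 accounts for the positive and negative parts of the real and
    imaginary parts of the multipliers. *)
Lemma norm_sum_multiplier_le u (t : nat -> R[i]) s (eps : R[i]) :
  (forall k, `|t k| <= 1) ->
  (forall s', subseq s' s -> `|\sum_(k <- s') u k| <= eps) ->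
  `|\sum_(k <- s) t k *: u k| <= eps *+ 4.
Proof.
move=> t1 seps.
have part (p : nat -> R) : (forall k, `|p k| <= 1) ->
    `|\sum_(k <- s) (Num.max (p k) 0)%:C *: u k| <= eps.
  move=> p1; rewrite -[X in `|X|]add0r; apply: norm_sum_convex_le.
    move=> k; rewrite ler0c lecR le_max lexx orbT/=.
    by rewrite ge_max (le_trans (ler_norm _))//=.
  by move=> s'; rewrite add0r; exact: seps.
have maxE (r : R) : r = Num.max r 0 - Num.max (- r) 0.
  by case: (leP r 0); case: (leP (- r) 0); lra.
pose p1 k := complex.Re (t k); pose p2 k := complex.Im (t k).
have p1P k : `|p1 k| <= 1 by rewrite -lecR (le_trans (normc_ge_Re _)).
have p2P k : `|p2 k| <= 1.
  rewrite -lecR (le_trans _ (t1 k))//.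
  have := normc_ge_Re (t k * 'i%C).
  by rewrite ReiNIm normrN normrM normc_i mulr1.
have -> : \sum_(k <- s) t k *: u k =
    (\sum_(k <- s) (Num.max (p1 k) 0)%:C *: u k -
     \sum_(k <- s) (Num.max (- p1 k) 0)%:C *: u k) +
    'i%C *: (\sum_(k <- s) (Num.max (p2 k) 0)%:C *: u k -
     \sum_(k <- s) (Num.max (- p2 k) 0)%:C *: u k).
  rewrite -!sumrB scaler_sumr -big_split; apply: eq_bigr => k _ /=.
  by rewrite -!scalerBl -!rmorphB/= -!maxE scalerA -scalerDl -complexE.
have -> : eps *+ 4 = eps + eps + (eps + eps) by rewrite -!mulr2n -mulrnA.
rewrite (le_trans (ler_normD _ _))// normrZ normc_i mul1r.
by rewrite lerD// (le_trans (ler_normB _ _))// lerD//; apply: part => k;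
  rewrite ?normrN.
Qed.

Lemma unconditional_multiplier u (t : nat -> R[i]) :
  unconditionally_convergent u -> (forall k, `|t k| <= 1) ->
  cvgn (series (fun k => t k *: u k)).
Proof.
move=> cu t1; apply/cauchy_cvgP/cauchy_seriesP => eps eps0.
have e8 : 0 < eps / 8 by rewrite divr_gt0.
have [N NP] := unconditional_cauchy cu e8.
exists ([set n | (N <= n)%N], setT) => /=.
  by split; [exists N|exact: filterT].
move=> [m n] [/= Nm _].
apply: (le_lt_trans
  (@norm_sum_multiplier_le u t (index_iota m n) (eps / 8) t1 _)).
  move=> s smn; apply: (NP n); apply: (subseq_trans smn).
  have [nm|mn] := leqP n m; first by rewrite /index_iota (eqP nm) sub0seq.
  have -> : index_iota N n = index_iota N m ++ index_iota m n.
    rewrite /index_iota -[in RHS](subnKC Nm) addKn -iotaD; congr iota; lia.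
  exact: suffix_subseq.
by rewrite -[_ *+ 4]mulr_natr -mulrA gtr_pMr// ltr_pdivrMl// mulr1 ltr_nat.
Qed.

End Unconditional.

(** * Closed ideals *)

Section Ideals.
Context {R : realType} {X : completeNormedModType R[i]} {e : nat -> X}.
Hypothesis Ue : unconditional_basis e.
Let Be : schauder_basis e := proj1 Ue.

(** The series defining [vabs] converges, as it arises from the expansion of x
    by multiplying each term by a scalar of modulus at most 1. *)
Lemma coef_vabs x : coef e (vabs e x) = fun n => `|coef e x n|.
Proof.
pose t n := `|coef e x n| / coef e x n.
have tE : (fun n => t n *: (coef e x n *: e n)) =
    (fun n => `|coef e x n| *: e n).
  apply/funext => n; rewrite scalerA /t.
  by have [->|c0] := eqVneq (coef e x n) 0; rewrite ?normr0 ?mul0r// divfK.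
apply: (expandsP Be); rewrite /expands.
have : cvgn (series (fun n => t n *: (coef e x n *: e n))).
  apply: unconditional_multiplier; first exact: (proj2 Ue).
  move=> n; rewrite normrM normfV normr_id.
  have [->|c0] := eqVneq (coef e x n) 0; first by rewrite normr0 mul0r.
  by rewrite divff ?normr_eq0.
by rewrite tE.
Qed.

Lemma closed_ideal_basis V y n :
  closed_ideal e V -> V y -> coef e y n != 0 -> V (e n).
Proof.
move=> [_ [V0 VD] Vle] Vy yn.
have : V (coef e y n *: e n).
  apply: Vle Vy => m; rewrite coefB// !coef_vabs coefZ// coef_basis//.
  by have [->|_] := eqVneq n m; rewrite ?mulr1 ?subrr// mulr0 normr0 subr0.
move=> /(VD (coef e y n)^-1 _ 0)/(_ V0).
by rewrite addr0 scalerA mulVf// scale1r.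
Qed.

Lemma closed_ideal_full V : closed_ideal e V -> (forall n, V (e n)) -> V = setT.
Proof.
move=> [cV [V0 VD] _] Ve; apply/seteqP; split=> // x _.
apply: (closed_cvg _ cV _ _ (@expands_coef _ _ _ Be x)); apply: nearW.
elim=> [|N IH]; first by rewrite /series/= big_geq.
by rewrite seriesSr addrC; exact: VD.
Qed.

Lemma nonzero_entries_no_ideal (T : bounded_op X X) :
  (forall n m, coef e (T (e n)) m != 0) ->
  no_nontrivial_closed_invariant_ideal e T.
Proof.
move=> T0 [V [iV [nV0 nVT] TV]]; apply: nVT; apply: closed_ideal_full => // m.
have [y [Vy y0]] : exists y, V y /\ y <> 0.
  apply: contrapT => /forallNP V0; apply: nV0.
  apply/seteqP; split=> [y Vy|_ ->] /=.
    by apply: contrapT => y0; apply: (V0 y).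
  by have [_ []] := iV.
have [n yn] : exists n, coef e y n != 0.
  apply: contrapT => /forallNP c0; apply: y0.
  apply: (cvg_unique _ (@expands_coef _ _ _ Be y)) => //=.
  apply: cvg_near_cst; apply: nearW => N; rewrite /series/= big1// => i _.
  by have /negP := c0 i; rewrite negbK => /eqP ->; rewrite scale0r.
apply: (closed_ideal_basis iV) (T0 n m).
by apply: TV; exists (e n) => //; exact: (closed_ideal_basis iV) yn.
Qed.

End Ideals.

(** * A positive contraction with positive entries *)

Section PositiveOperator.
Context {R : realType} {X : completeNormedModType R[i]} {e : nat -> X}.
Hypothesis Be : schauder_basis e.

(** Each b k is equal to its modulus, hence so is the limit. *)
Lemma cvg_ge0_complex (b : nat -> R[i]) (l : R[i]) :
  (b : nat -> R[i]^o) @ \oo --> (l : R[i]^o) -> (forall k, 0 <= b k) -> 0 <= l.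
Proof.
move=> bl b0.
have bE : b = (fun k => `|b k|) by apply/funext => k; rewrite ger0_norm.
have nb := cvg_norm bl.
have -> : l = `|l|; last exact: normr_ge0.
apply: (cvg_unique (@norm_hausdorff _ R[i]^o) bl).
by rewrite [in X in X @ _]bE; exact: nb.
Qed.

Lemma geometric_series_realified (w : nat -> X) (c : R) :
  (forall k, `|w k| <= (c * 2^-1 ^+ k)%:C) ->
  exists2 l, series w @ \oo --> l & `|l| <= (c * 2)%:C.
Proof.
move=> wc; have [|l wl lP] := @geometric_dominated_series _ (realified X) w c.
  by move=> k; rewrite -lecR -normr_realified; exact: wc.
exists l; first by rewrite cvg_realified; exact: wl.
have := lP 0%N; rewrite /series/= big_geq// expr0 mulr1 subr0.
by rewrite normr_realified lecR.
Qed.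

Lemma positive_vector_ex : exists2 u : X, `|u| <= 1 & forall m, 0 < coef e u m.
Proof.
pose a m := (2^-1 ^+ m.+1)%:C / `|e m|.
have a0 m : 0 < a m.
  by rewrite divr_gt0 ?normr_gt0 ?basis_neq0// ltcR.
have [|u au u1] := @geometric_series_realified (fun m => a m *: e m) (2^-1).
  move=> m; rewrite normrZ gtr0_norm// divfK ?exprS//.
  by rewrite normr_eq0 basis_neq0.
exists u; first by rewrite (le_trans u1)// mulVf.
by move=> m; rewrite (expandsP Be au).
Qed.

(** S x := (sum of w_n x_n) u, where u is a positive vector of the unit ball and
    the weights w_n absorb the norms of the coordinate functionals.  The series
    is summed in X, which is complete. *)
Lemma positive_entries_ex :
  exists2 S : bounded_op X X, P1 e S & forall n m, 0 < coef e (S (e n)) m.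
Proof.
have [u u1 u0] := positive_vector_ex.
have /choice[K KP] n : exists K : R, 0 < K /\
    forall x, `|coef e x n| <= K%:C * `|x|.
  by have [K K0 KP] := coef_bounded Be n; exists K.
pose w n : R[i] := (2^-1 ^+ n.+1 / K n)%:C.
have w0 n : 0 < w n by have [K0 _] := KP n; rewrite ltcR divr_gt0.
have /choice[S SP] x : exists y,
    series (fun n => (w n * coef e x n) *: u) @ \oo --> y /\ `|y| <= `|x|.
  have [|y xy yx] := @geometric_series_realified
      (fun n => (w n * coef e x n) *: u) (2^-1 * complex.Re `|x|).
    move=> n; rewrite normrZ normrM gtr0_norm//.
    have [K0 /(_ x) Kx] := KP n.
    apply: (le_trans (ler_piMr _ u1)); first by rewrite mulr_ge0// ltW.
    apply: (le_trans (ler_wpM2l (ltW (w0 n)) Kx)); rewrite [in leLHS](normRe x).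
    rewrite /w -!rmorphM lecR/= mulrA divfK ?gt_eqF// exprS.
    by rewrite -!mulrA [complex.Re _ * _]mulrC.
  exists y; split => //; rewrite (le_trans yx)// mulrAC mulVf// mul1r.
  by rewrite -normRe.
have S_lin : linear S.
  move=> a x y; apply: (cvg_unique _ (proj1 (SP _))) => //=.
  have -> : (fun n => (w n * coef e (a *: x + y) n) *: u) =
      (fun n => (a * (w n * coef e x n) + w n * coef e y n) *: u).
    by apply/funext => n; rewrite coef_linear// mulrDr mulrCA.
  have -> := funext (series_linear (fun=> u) a (fun n => w n * coef e x n)
    (fun n => w n * coef e y n)).
  by apply: cvgD; [apply: cvgZl_tmp|]; exact: (proj1 (SP _)).
have S_cont : continuous S.
  move=> x; apply/cvgrPdist_lt => eps eps0; near=> y.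
  have -> : S x - S y = S (x - y).
    by rewrite addrC -scaleN1r [x - y]addrC -[- y]scaleN1r S_lin.
  by rewrite (le_lt_trans (proj2 (SP _))).
have S_op : S \in is_bounded_op by apply/asboolP.
have SuE n : S (e n) = w n *: u.
  have : series (fun k => (w k * coef e (e n) k) *: u) @ \oo --> w n *: u.
    apply: cvg_near_cst; exists n.+1 => // N /= nN.
    rewrite /series/= (bigD1_seq n) ?iota_uniq ?mem_index_iota//=.
    rewrite coef_basis// eqxx mulr1.
    rewrite big1 ?addr0// => i /negPf im.
    by rewrite coef_basis// eq_sym im mulr0 scale0r.
  exact: (cvg_unique _ (proj1 (SP _))).
exists (BoundedOp S_op); last first.
  by move=> n m /=; rewrite SuE coefZ// mulr_gt0.
split.
  move=> x x0 m /=.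
  apply: (cvg_ge0_complex (b := fun N =>
      coef e (series (fun n => (w n * coef e x n) *: u) N) m)).
    exact: (cvg_comp _ _ (proj1 (SP x)) (@coef_continuous _ _ _ Be m (S x))).
  move=> N; rewrite /series/= -scaler_suml coefZ//.
  apply: mulr_ge0; last exact: ltW.
  by apply: sumr_ge0 => i _; rewrite mulr_ge0// ltW.
rewrite -[leRHS]/(1%:C) lecR; apply: opnorm_le => x x1 /=.
exact: le_trans (proj2 (SP x)) x1.
Unshelve. all: by end_near.
Qed.

End PositiveOperator.

(** * Genericity *)

Section Typical.
Context {R : realType} {X : completeNormedModType R[i]} {e : nat -> X}.
Hypothesis Ue : unconditional_basis e.
Let Be : schauder_basis e := proj1 Ue.

Lemma coef_perturb (T S : bounded_op X X) (t : R) x n :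
  coef e ((T + t%:C *: (S - T)) x) n =
  t%:C * coef e (S x) n + (1 - t%:C) * coef e (T x) n.
Proof.
have -> : (T + t%:C *: (S - T)) x = t%:C *: (S x - T x) + T x.
  by rewrite [RHS]addrC.
by rewrite coef_linear// coefB// mulrBr mulrBl mul1r -addrA [- _ + _]addrC.
Qed.

Lemma positive_contraction_convex (T S : bounded_op X X) (t : R) :
  0 <= t <= 1 -> P1 e T -> P1 e S -> P1 e (T + t%:C *: (S - T)).
Proof.
move=> /andP[t0 t1] [Tpos T1] [Spos S1].
have t0C : 0 <= t%:C by rewrite ler0c.
have t1C : 0 <= 1 - t%:C by rewrite subr_ge0 -[leRHS]/(1%:C) lecR.
split.
  move=> x x0 n.
  rewrite coef_perturb.
  by rewrite addr_ge0// mulr_ge0//; [exact: Spos|exact: Tpos].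
have -> : T + t%:C *: (S - T) = t%:C *: S + (1 - t%:C) *: T.
  by rewrite scalerBr scalerBl scale1r addrCA.
rewrite (le_trans (ler_normD _ _))// !normrZ !ger0_norm//.
rewrite -[leRHS](subrK t%:C) [leRHS]addrC.
by rewrite lerD// -[leRHS]mulr1 ler_wpM2l.
Qed.

(** Both topologies on the positive contractions are initial for a map F.  The
    openness of the sets where an entry is nonzero requires T |-> T x to be
    continuous; the density of their intersection requires F to see the
    convergence of the perturbations T + D / (k + 1) to T. *)
Lemma typical_nonzero_entries (W : topologicalType) (F : P1 e -> W) :
  (forall x, continuous (fun T : initial_topology F =>
    (val (T : P1 e) : bounded_op X X) x)) ->
  (forall (T : P1 e) (D : bounded_op X X) (s : nat -> P1 e),
    (forall k, val (s k) = val T + (k.+1%:R^-1)%:C *: D) ->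
    F (s k) @[k --> \oo] --> F T) ->
  typical (T := initial_topology F)
    (fun T => no_nontrivial_closed_invariant_ideal e (val T)).
Proof.
move=> Fc Fcvg.
pose entry n m (T : P1 e) := coef e ((val T : bounded_op X X) (e n)) m.
pose G n m : set (initial_topology F) := [set T : P1 e | entry n m T != 0].
(* An enumeration of the pairs of indices; (0, 0) is a default value. *)
pose decode k : nat * nat := odflt (0, 0)%N (unpickle k).
exists (\bigcap_k G (decode k).1 (decode k).2); split.
- exists (fun k => G (decode k).1 (decode k).2) => // k.
  move: (decode k) => [n m] /=.
  have -> : G n m = (fun T : initial_topology F => entry n m T : R[i]^o)
      @^-1` ~` [set 0].
    by apply/seteqP; split=> T /= /eqP.
  apply: open_comp; last first.
    apply: closed_openC; apply: accessible_closed_set1.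
    exact/hausdorff_accessible/norm_hausdorff.
  move=> T _.
  exact: (cvg_comp _ _ (Fc (e n) T) (@coef_continuous _ _ _ Be m _)).
- move=> O [T OT] [B oB BO].
  have [S S1 S0] := positive_entries_ex Be.
  have t01 k : 0 <= (k.+1%:R^-1 : R) <= 1.
    by rewrite invr_ge0 ler0n/= invf_le1// ler1n.
  pose s k : P1 e := SigSub (mem_set
    (@positive_contraction_convex _ S _ (t01 k) (set_mem (valP T)) S1)).
  have [k _ kB] : \forall k \near \oo, B (F (s k)).
    apply: (Fcvg T (S - val T) s) => //.
    by apply: open_nbhs_nbhs; split=> //; move: OT; rewrite -BO.
  exists (s k); split; first by rewrite -BO; exact: (kB k (leqnn k)).
  move=> i _; move: (decode i) => [n m] /=.
  change (entry n m (s k) != 0).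
  have -> : entry n m (s k) = coef e
      (((val T : bounded_op X X) + (k.+1%:R^-1)%:C *: (S - val T)) (e n)) m.
    by [].
  rewrite coef_perturb gt_eqF// ltr_wpDr//; last first.
    by rewrite mulr_gt0// ltcR invr_gt0 ltr0n.
  have [Tpos _] := set_mem (valP T).
  rewrite mulr_ge0//; first by rewrite subr_ge0 lecR; case/andP: (t01 k).
  by apply: Tpos => j; rewrite coef_basis// ler0n.
- move=> T TG; apply: nonzero_entries_no_ideal => // n m.
  by have := TG (pickle (n, m)) I; rewrite /decode pickleK.
Qed.

End Typical.

Theorem proposition1p6 (R : realType) (X : completeNormedModType R[i])
  (e : nat -> X) :
  infinite_dimensional X -> unconditional_basis e ->
  typical (T := P1_SOT e)
    (fun T => no_nontrivial_closed_invariant_ideal e (val T)) /\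
  (separable_space (dual X) ->
   typical (T := P1_SOTstar e)
     (fun T => no_nontrivial_closed_invariant_ideal e (val T))).
Proof.
move=> _ Ue.
have invn0 : (fun k => (k.+1%:R^-1)%:C : R[i]^o) @ \oo --> (0 : R[i]^o).
  by apply: cvg_complex; [exact: cvg_harmonic|exact: cvg_cst].
have cvg_pert (V : normedModType R[i]) (v d : V) :
    v + (k.+1%:R^-1)%:C *: d @[k --> \oo] --> v.
  rewrite -[X in _ --> X]addr0 -(scale0r d).
  by apply: cvgD; [exact: cvg_cst|apply: cvgZr_tmp].
have SOT_cvg (T : P1 e) (D : bounded_op X X) (s : nat -> P1 e) :
    (forall k, val (s k) = val T + (k.+1%:R^-1)%:C *: D) ->
    ((val (s k) : X -> X) : {ptws X -> X}) @[k --> \oo] -->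
    ((val T : X -> X) : {ptws X -> X}).
  move=> sE; apply/pointwise_cvgP => x; rewrite -fmap_comp.
  rewrite (_ : _ \o _ = fun k =>
    (val T : bounded_op X X) x + (k.+1%:R^-1)%:C *: D x); first exact: cvg_pert.
  by apply/funext => k /=; rewrite sE.
split=> [|_]; apply: typical_nonzero_entries => //.
- by move=> x T; exact: (cvg_comp _ _ (@initial_continuous _ _ _ T)
    (@proj_continuous _ _ x _)).
- move=> x T; have cF := @initial_continuous _ _ (fun T : P1 e =>
    ((val T : X -> X) : {ptws X -> X},
     adjoint (val T) : {ptws dual X -> dual X})) T.
  exact: (cvg_comp _ _ (cvg_comp _ _ cF cvg_fst) (@proj_continuous _ _ x _)).
- move=> T D s sE; apply: (cvg_pair (SOT_cvg _ _ _ sE) (H := nbhs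
    (adjoint (val T) : {ptws dual X -> dual X}))).
  apply/pointwise_cvgP => f; rewrite -fmap_comp.
  rewrite (_ : _ \o _ = fun k =>
    adjoint (val T) f + (k.+1%:R^-1)%:C *: adjoint D f); first exact: cvg_pert.
  apply/funext => k; apply/val_inj/funext => x /=.
  by rewrite sE linearD linearZ.
Qed.
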